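(* For any finite graph $G=(V,E)$, and any fixed ordering of the edge set $E$, \[H^*(F^{\mathrm{CS}})\cong H^*(F^{\mathrm{CS}}|_{\mathrm{NBC}}),\] where $F^{\mathrm{CS}}=F^{\mathrm{CS}}_G:2^E\to\mathbb{C}[S_n]\text{-}\mathbf{gmod}$, $n=|V|$, is the chromatic symmetric functor.
   Context: A finite graph $G=(V,E)$ consists of a finite set $V$ and a set $E$ of 2-element subsets of $V$. A cycle is (the edge set of) a closed sequence $x_1,\dots,x_k,x_1$ with $k\ge 3$, $x_1,\dots,x_k$ distinct vertices and each $\{x_i,x_{i+1}\}$ an edge (indices mod $k$). Fix an ordering $e_1,\dots,e_m$ of $E$. A broken circuit is a set $C\setminus\{e\}$ where $C\subseteq E$ is a cycle and $e$ is the edge of $C$ with the largest label. $\mathrm{NBC}$ is the set of all $S\subseteq E$ that contain no broken circuit; it is a lower order ideal of the Boolean lattice $2^E$ (subsets of $E$ ordered by inclusion). $\mathbb{C}[S_n]\text{-}\mathbf{gmod}$ is the category of graded $\mathbb{C}[S_n]$-modules and degree-preserving homomorphisms. $S^\lambda$ is the irreducible $\mathbb{C}[S_n]$-module indexed by the partition $\lambda\vdash n$. For $n\in\mathbb{N}$, $n\ge1$, let $\mathcal{L}_n$ be the graded $\mathbb{C}[S_n]$-module \[\mathcal{L}_n=\bigwedge\nolimits^{*}S^{(n-1,1)}=\bigoplus_{k=0}^{n-1}\bigwedge\nolimits^{k}S^{(n-1,1)}=\bigoplus_{k=0}^{n-1}S^{(n-k,1^k)}\{k\},\] where $\{k\}$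 shifts the grading up by $k$, so the $k$-th exterior power sits in degree $k$ (for $n=1$ this is the trivial module in degree $0$). For $T\subseteq E$, let $B_1,\dots,B_r$ be the vertex sets of the connected components of the spanning subgraph $(V,T)$, $b_i=|B_i|$, and let \[\mathcal{M}_T=\mathrm{Ind}_{S_{B_1}\times\cdots\times S_{B_r}}^{S_{V}}(\mathcal{L}_{b_1}\otimes\cdots\otimes\mathcal{L}_{b_r}),\qquad S_V\cong S_n,\] which depends only on the partition of $V$ into components of $T$. The chromatic symmetric functor $F^{\mathrm{CS}}$ is a functor on the poset $2^E$ (viewed as a category) with $F^{\mathrm{CS}}(T)=\mathcal{M}_T$ and $F^{\mathrm{CS}}(T\lessdot T\cup\{e\})=d_{T\lessdot T\cup\{e\}}:\mathcal{M}_T\to\mathcal{M}_{T\cup\{e\}}$ on cover relations, where $d_{T\lessdot T\cup\{e\}}$ is the identity map whenever adding $e$ to $T$ completes a cycle. When $e$ joins two distinct components, $d_{T\lessdot T\cup\{e\}}$ is a prescribed morphism of graded $\mathbb{C}[S_n]$-modules (the one of Sazdanović and Yip); the statement is to be read for any such choice making $F^{\mathrm{CS}}$ a functor. Let $c(T\lessdot T\cup\{e_i\})=(-1)^{\#\{e_j\in T\,:\,j<i\}}$. For a lower order ideal $Q$ of $2^E$ (in particular $Q=2^E$ or $Q=\mathrm{NBC}$), $H^*(F^{\mathrm{CS}}|_Q)$ is the cohomology of the cochain complex with $C^k=\bigoplus_{T\in Q,\,|T|=k}F^{\mathrm{CS}}(T)$ and differential $\delta^k=\sum c(T\lessdot T')F^{\mathrm{CS}}(T\lessdot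 T')$, summed over cover relations $T\lessdot T'$ in $Q$ with $|T|=k$. *)

(* Defs.v *)
From HB Require Import structures.
From mathcomp Require Import all_boot all_order all_algebra all_fingroup.
From mathcomp Require Import generic_quotient ring_quotient.
From mathcomp Require Import boolp freeg.

Set Implicit Arguments.
Unset Strict Implicit.
Unset Printing Implicit Defensive.

Import GRing.Theory.
Local Open Scope quotient_scope.
Local Open Scope ring_scope.

(** ** Linear algebra over a field: quotients, direct sums, tensor products,
    exterior powers *)

Section Span.
Variables (K : fieldType) (W : lmodType K) (P : W -> Prop).

Inductive span : W -> Prop :=
| span0 : span 0
| spanDZ (a : K) u v : P u -> span v -> span (a *: u + v).

Definition spanp : {pred W} := fun w => `[< span w >].

Lemma spanD u v : span u -> span v -> span (u + v).
Proof.
move=> su sv; elim: su => [|a x y Px _ IH]; first by rewrite add0r.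
by rewrite -addrA; apply: spanDZ.
Qed.

Lemma spanZ a u : span u -> span (a *: u).
Proof.
elim=> [|b x y Px _ IH]; first by rewrite scaler0; apply: span0.
by rewrite scalerDr scalerA; apply: spanDZ.
Qed.

Lemma span_gen u : P u -> span u.
Proof. by move=> Pu; rewrite -[u]addr0 -[u]scale1r; apply: spanDZ => //; apply: span0. Qed.

Lemma spanp_submod_closed : submod_closed spanp.
Proof.
split=> [|a u v /asboolP su /asboolP sv]; apply/asboolP; first exact: span0.
by apply: spanD => //; apply: spanZ.
Qed.

HB.instance Definition _ := GRing.isSubmodClosed.Build K W spanp
  spanp_submod_closed.

(* W / span P; [Quotient.quot] is the library's additive quotient group. *)
Definition lquot : Type := Quotient.quot spanp.

HB.instance Definition _ := GRing.Zmodule.on lquot.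

Definition lq (w : W) : lquot := \pi_(Quotient.quot spanp) w.

Lemma lq_eq u v : (lq u = lq v) <-> span (u - v).
Proof.
rewrite /lq; split.
  by move/eqP; rewrite -Quotient.idealrBE => /asboolP.
by move=> s; apply/eqP; rewrite -Quotient.idealrBE; apply/asboolP.
Qed.

Definition lqrepr (q : lquot) : W := repr (q : Quotient.quot spanp).

Lemma lqreprK : cancel lqrepr lq.
Proof. exact: reprK. Qed.

Lemma lqD u v : lq (u + v) = lq u + lq v.
Proof. exact: (raddfD (\pi_(Quotient.quot spanp))). Qed.

Definition lqscale (a : K) (q : lquot) : lquot := lq (a *: lqrepr q).

Lemma lqscaleE a u : lqscale a (lq u) = lq (a *: u).
Proof.
apply/lq_eq; rewrite -scalerBr; apply: spanZ; apply/lq_eq.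
exact: lqreprK.
Qed.

Lemma lqscaleA a b q : lqscale a (lqscale b q) = lqscale (a * b) q.
Proof. by rewrite -[q]lqreprK !lqscaleE scalerA. Qed.
Lemma lqscale1 q : lqscale 1 q = q.
Proof. by rewrite -[q]lqreprK lqscaleE scale1r. Qed.
Lemma lqscaleDr a p q : lqscale a (p + q) = lqscale a p + lqscale a q.
Proof. by rewrite -[p]lqreprK -[q]lqreprK -lqD !lqscaleE scalerDr lqD. Qed.
Lemma lqscaleDl q a b : lqscale (a + b) q = lqscale a q + lqscale b q.
Proof. by rewrite -[q]lqreprK !lqscaleE scalerDl lqD. Qed.

HB.instance Definition _ := GRing.Zmodule_isLmodule.Build K lquot
  lqscaleA lqscale1 lqscaleDr lqscaleDl.

Lemma lq_is_linear : linear lq.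
Proof. by move=> a u v; rewrite lqD -lqscaleE. Qed.

HB.instance Definition _ := GRing.isLinear.Build K W lquot *:%R lq lq_is_linear.

End Span.

Section QuotientMap.
Variables (K : fieldType) (W W' : lmodType K) (P : W -> Prop) (P' : W' -> Prop).
Variable f : {linear W -> W'}.
Hypothesis fP : forall w, P w -> span P' (f w).

Definition lqmap_fun of (forall w, P w -> span P' (f w)) :=
  fun q : lquot P => lq P' (f (lqrepr q)).
Local Notation F := (lqmap_fun fP).

Lemma lqmap_funE w : F (lq P w) = lq P' (f w).
Proof.
apply/lq_eq; rewrite -linearB.
have : span P (lqrepr (lq P w) - w) by apply/lq_eq; exact: lqreprK.
elim=> [|a u v Pu _ IH]; first by rewrite linear0; apply: span0.
by rewrite linearP; apply: spanD => //; apply: spanZ; apply: fP.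
Qed.

Lemma lqmap_is_linear : linear F.
Proof.
move=> a p q; rewrite -[p]lqreprK -[q]lqreprK -linearP !lqmap_funE.
by rewrite !linearP.
Qed.

HB.instance Definition _ :=
  GRing.isLinear.Build K (lquot P) (lquot P') *:%R F lqmap_is_linear.

Definition lqmap : {linear lquot P -> lquot P'} := F.

Lemma lqmapE w : lqmap (lq P w) = lq P' (f w).
Proof. exact: lqmap_funE. Qed.

End QuotientMap.

Section DirectSum.
Variables (K : fieldType) (I : finType) (W : I -> lmodType K).

Definition dsum : Type := {dffun forall i, W i}.

HB.instance Definition _ := Choice.on dsum.

Implicit Types f g h : dsum.

Definition dsum_add f g : dsum := [ffun i => (f i + g i : W i)].
Definition dsum_opp f : dsum := [ffun i => (- f i : W i)].
Definition dsum_zero : dsum := [ffun i => (0 : W i)].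
Definition dsum_scale (a : K) f : dsum := [ffun i => (a *: f i : W i)].

Fact dsum_addA : associative dsum_add.
Proof. by move=> f g h; apply/ffunP => i; rewrite !ffunE addrA. Qed.
Fact dsum_addC : commutative dsum_add.
Proof. by move=> f g; apply/ffunP => i; rewrite !ffunE addrC. Qed.
Fact dsum_add0 : left_id dsum_zero dsum_add.
Proof. by move=> f; apply/ffunP => i; rewrite !ffunE add0r. Qed.
Fact dsum_addN : left_inverse dsum_zero dsum_opp dsum_add.
Proof. by move=> f; apply/ffunP => i; rewrite !ffunE addNr. Qed.

HB.instance Definition _ :=
  GRing.isZmodule.Build dsum dsum_addA dsum_addC dsum_add0 dsum_addN.

Fact dsum_scaleA a b f : dsum_scale a (dsum_scale b f) = dsum_scale (a * b) f.
Proof. by apply/ffunP => i; rewrite !ffunE scalerA. Qed.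
Fact dsum_scale1 f : dsum_scale 1 f = f.
Proof. by apply/ffunP => i; rewrite !ffunE scale1r. Qed.
Fact dsum_scaleDr a f g : dsum_scale a (f + g) = dsum_scale a f + dsum_scale a g.
Proof. by apply/ffunP => i; rewrite !ffunE scalerDr. Qed.
Fact dsum_scaleDl f a b : dsum_scale (a + b) f = dsum_scale a f + dsum_scale b f.
Proof. by apply/ffunP => i; rewrite !ffunE scalerDl. Qed.

HB.instance Definition _ := GRing.Zmodule_isLmodule.Build K dsum
  dsum_scaleA dsum_scale1 dsum_scaleDr dsum_scaleDl.

Lemma dsumDE f g i : (f + g) i = f i + g i. Proof. by rewrite ffunE. Qed.
Lemma dsumZE a f i : (a *: f) i = a *: f i. Proof. by rewrite ffunE. Qed.

End DirectSum.

Section DirectSumMap.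
Variables (K : fieldType) (I : finType) (W W' : I -> lmodType K).
Variable phi : forall i, {linear W i -> W' i}.

Definition dsum_map_fun (f : dsum W) : dsum W' := [ffun i => phi i (f i)].

Lemma dsum_map_is_linear : linear dsum_map_fun.
Proof.
move=> a f g; apply/ffunP => i.
by rewrite ffunE dsumDE dsumZE linearP dsumDE dsumZE !ffunE.
Qed.

HB.instance Definition _ :=
  GRing.isLinear.Build K (dsum W) (dsum W') *:%R dsum_map_fun dsum_map_is_linear.

Definition dsum_map : {linear dsum W -> dsum W'} := dsum_map_fun.
End DirectSumMap.

Section FreeModule.
Variables (K : fieldType) (X : choiceType) (M : lmodType K) (f : X -> M).

Lemma freeg_ind (P : {freeg X / K} -> Prop) :
  P 0 -> (forall a x D, P D -> P (a *: << x >> + D)) -> forall D, P D.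
Proof.
move=> P0 PD D; rewrite -[D]freeg_sumE.
elim: (dom D) => [|x s IH]; first by rewrite big_nil.
rewrite big_cons; suff -> : << coeff x D *g x >> = coeff x D *: << x >> :> {freeg X / K}.
  exact: PD.
by apply/eqP/freeg_eqP => z; rewrite coeffZ !coeffU mul1r.
Qed.

Lemma fglift_is_linear : linear (fglift f).
Proof.
have add : forall D E : {freeg X / K}, fglift f (D + E) = fglift f D + fglift f E.
  have sub := lift_is_additive f.
  have f0 : fglift f 0 = 0 by rewrite -[0 in LHS](subrr 0) sub subrr.
  have opp D : fglift f (- D) = - fglift f D by rewrite -[- D]add0r sub f0 sub0r.
  by move=> D E; rewrite -[E in LHS]opprK sub opp opprK.
move=> a D E; rewrite add; congr (_ + _).
rewrite -[D]freeg_sumE.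
elim: (dom D) => [|x s IH].
  have f0 : fglift f 0 = 0 by apply: (addrI (fglift f 0)); rewrite -add !addr0.
  by rewrite !big_nil scaler0 f0 scaler0.
rewrite !big_cons scalerDr !add scalerDr IH; congr (_ + _).
rewrite (_ : a *: _ = << a * coeff x D *g x >>); last first.
  by apply/eqP/freeg_eqP => z; rewrite coeffZ !coeffU mulrA.
by rewrite !liftU scalerA.
Qed.

HB.instance Definition _ := GRing.isLinear.Build K {freeg X / K} M *:%R
  (fglift f) fglift_is_linear.

Lemma fgliftE x : fglift f << x >> = f x.
Proof. by rewrite liftU scale1r. Qed.

End FreeModule.

Section Tensor.
Variables (K : fieldType) (I : finType).

Section Def.
Variable W : I -> lmodType K.

Definition multilin_rel (z : {freeg {dffun forall i, W i} / K}) : Prop :=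
  exists (i : I) (a : K) (f g h : {dffun forall i, W i}),
    [/\ h i = a *: f i + g i,
        forall j, j != i -> f j = h j /\ g j = h j
      & z = << h >> - (a *: << f >> + << g >>)].

Definition tens : lmodType K := lquot multilin_rel.

Definition pure (w : {dffun forall i, W i}) : tens := lq multilin_rel << w >>.

Lemma tens_ext (U : lmodType K) (F G : {linear tens -> U}) :
  (forall w, F (pure w) = G (pure w)) -> F =1 G.
Proof.
move=> FG q; rewrite -[q]lqreprK; elim/freeg_ind: (lqrepr q) => [|a x D IH].
  by rewrite !linear0.
by rewrite !linearP IH; congr (_ *: _ + _); exact: FG.
Qed.
End Def.

Section Map.
Variables (W W' : I -> lmodType K) (phi : forall i, {linear W i -> W' i}).

Definition fam_map (w : {dffun forall i, W i}) : {dffun forall i, W' i} :=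
  [ffun i => phi i (w i)].

Definition fgmap : {linear {freeg {dffun forall i, W i} / K} ->
    {freeg {dffun forall i, W' i} / K}} :=
  fglift (fun w => << fam_map w >> : {freeg {dffun forall i, W' i} / K}).

Lemma tens_map_subproof z :
  multilin_rel z -> span (@multilin_rel W') (fgmap z).
Proof.
move=> [i [a [f [g [h [hi hj ->]]]]]]; apply: span_gen.
exists i, a, (fam_map f), (fam_map g), (fam_map h); split.
- by rewrite !ffunE hi linearP.
- by move=> j /hj [e1 e2]; rewrite !ffunE e1 e2.
by rewrite linearB linearP /= !fgliftE.
Qed.

Definition tens_map : {linear tens W -> tens W'} := lqmap tens_map_subproof.

Lemma tens_mapE w : tens_map (pure w) = pure (fam_map w).
Proof. by rewrite /tens_map /pure lqmapE /= fgliftE. Qed.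
End Map.
End Tensor.

Section Exterior.
Variables (K : fieldType) (k : nat).

Section Def.
Variable W : lmodType K.

Definition alt_rel (z : tens (fun _ : 'I_k => W)) : Prop :=
  exists w : {dffun forall _ : 'I_k, W},
    (exists i j, i != j /\ w i = w j) /\ z = pure w.

Definition ext : lmodType K := lquot alt_rel.

Lemma ext_ext (U : lmodType K) (F G : {linear ext -> U}) :
  (forall w, F (lq alt_rel (pure w)) = G (lq alt_rel (pure w))) -> F =1 G.
Proof.
move=> FG q; rewrite -[q]lqreprK.
exact: (@tens_ext _ _ _ _ (F \o lq alt_rel) (G \o lq alt_rel)).
Qed.
End Def.

Section Map.
Variables (W W' : lmodType K) (phi : {linear W -> W'}).

Lemma ext_map_subproof z :
  @alt_rel W z -> span (@alt_rel W') (tens_map (fun _ : 'I_k => phi) z).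
Proof.
move=> [w [[i [j [nij wij]]] ->]]; rewrite tens_mapE; apply: span_gen.
exists (fam_map (fun=> phi) w); split=> //.
by exists i, j; split=> //; rewrite !ffunE wij.
Qed.

Definition ext_map : {linear ext W -> ext W'} := lqmap ext_map_subproof.

Lemma ext_mapE w : ext_map (lq _ (pure w)) = lq _ (pure (fam_map (fun=> phi) w)).
Proof. by rewrite /ext_map lqmapE tens_mapE. Qed.
End Map.
End Exterior.

Section Kernel.
Variables (K : fieldType) (U V : lmodType K) (f : {linear U -> V}).

Definition kerp : {pred U} := fun u => f u == 0.

Lemma kerp_submod_closed : submod_closed kerp.
Proof.
split=> [|a u v]; rewrite /kerp !unfold_in ?linear0 //.
by move=> /eqP fu /eqP fv; rewrite linearP fu fv scaler0 addr0.
Qed.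

HB.instance Definition _ := GRing.isSubmodClosed.Build K U kerp kerp_submod_closed.

Record ker : Type := Ker { kval : U; _ : kval \in kerp }.

HB.instance Definition _ := [isSub for kval].
HB.instance Definition _ := [Choice of ker by <:].
HB.instance Definition _ := [SubChoice_isSubLmodule of ker by <:].
End Kernel.

(** ** Graded modules over a group algebra *)

(* MathComp composes permutations from left to right, (s * t) x = t (s x), so
   a left module over K[S_V] for the usual composition of maps is a right
   module for MathComp's product; hence the order in [gact_mul]. *)
Record gmod (K : fieldType) (gT : finGroupType) := Gmod {
  gcar :> nat -> lmodType K;
  gact : forall j, gT -> {linear gcar j -> gcar j};
  gact_one : forall j x, gact j 1%g x = x;
  gact_mul : forall j g h x, gact j (g * h)%g x = gact j h (gact j g x) }.

Arguments gact {K gT} _ j _.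

Record ghom (K : fieldType) (gT : finGroupType) (A B : gmod K gT) := Ghom {
  ghom_map :> forall j, {linear A j -> B j};
  ghom_act : forall j g x, ghom_map j (gact A j g x) = gact B j g (ghom_map j x) }.

Section GradedModules.
Variables (K : fieldType).

Definition gid (gT : finGroupType) (A : gmod K gT) : ghom A A :=
  @Ghom K gT A A (fun j => idfun) (fun _ _ _ => erefl).

Definition gmod_iso (gT : finGroupType) (A B : gmod K gT) : Prop :=
  exists f : ghom A B, forall j, bijective (f j).

Section Restriction.
Variables (gT hT : finGroupType) (r : {morphism [set: hT] >-> gT}) (A : gmod K gT).

Definition gres_act j (h : hT) := gact A j (r h).

Lemma gres_one j x : gres_act j 1%g x = x.
Proof. by rewrite /gres_act morph1 gact_one. Qed.

Lemma gres_mul j g h x : gres_act j (g * h)%g x = gres_act j h (gres_act j g x).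
Proof. by rewrite /gres_act morphM ?inE // gact_mul. Qed.

Definition gres : gmod K hT := Gmod gres_one gres_mul.
End Restriction.

(* Tensor product over [I] of graded modules over one group (diagonal action);
   the degree-j part is the direct sum of the tensor products of homogeneous
   parts of degrees k i with \sum_i k i = j. *)
Section GradedTensor.
Variables (gT : finGroupType) (I : finType) (A : I -> gmod K gT).

Definition degs (j : nat) : finType :=
  {k : {ffun I -> 'I_j.+1} | (\sum_i k i)%N == j}.

Definition gtens_car (j : nat) : lmodType K :=
  dsum (fun k : degs j => tens (fun i => A i (val k i))).

Definition gtens_act j (g : gT) : {linear gtens_car j -> gtens_car j} :=
  dsum_map (fun k : degs j => tens_map (fun i => gact (A i) (val k i) g)).

Lemma gtens_one j x : gtens_act j 1%g x = x.
Proof.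
apply/ffunP => k; rewrite ffunE; apply: (tens_ext (G := idfun)) => w.
by rewrite tens_mapE; congr pure; apply/ffunP => i; rewrite ffunE gact_one.
Qed.

Lemma gtens_mul j g h x : gtens_act j (g * h)%g x = gtens_act j h (gtens_act j g x).
Proof.
apply/ffunP => k; rewrite !ffunE.
apply: (tens_ext (G := tens_map (fun i => gact (A i) (val k i) h) \o
                       tens_map (fun i => gact (A i) (val k i) g))) => w.
by rewrite /= !tens_mapE; congr pure; apply/ffunP => i; rewrite !ffunE gact_mul.
Qed.

Definition gtens : gmod K gT := Gmod gtens_one gtens_mul.
End GradedTensor.

(* Ind_H^G N = N (x)_{K[H]} K[G]; [gdelta n g] represents n (x) g. *)
Section Induction.
Variables (gT : finGroupType) (H : {group gT}) (N : gmod K (subg_of H)).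

Definition gdelta j (n : N j) (g : gT) : dsum (fun _ : gT => N j) :=
  [ffun x => if x == g then n else 0].

Definition ind_rel j (z : dsum (fun _ : gT => N j)) : Prop :=
  exists (n : N j) (h : subg_of H) (g : gT),
    z = gdelta (gact N j h n) g - gdelta n (sgval h * g)%g.

Definition ind_car j : lmodType K := lquot (@ind_rel j).

Section Shift.
Variables (j : nat) (y : gT).

Definition shift_fun (f : dsum (fun _ : gT => N j)) : dsum (fun _ : gT => N j) :=
  [ffun x => f (x * y^-1)%g].

Lemma shift_is_linear : linear shift_fun.
Proof. by move=> a f g; apply/ffunP => x; rewrite !(dsumDE, dsumZE, ffunE). Qed.

HB.instance Definition _ := GRing.isLinear.Build K (dsum (fun _ : gT => N j))
  (dsum (fun _ : gT => N j)) *:%R shift_fun shift_is_linear.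

Lemma shift_delta n g : shift_fun (gdelta n g) = gdelta n (g * y)%g.
Proof.
apply/ffunP => x; rewrite !ffunE; congr (if _ then _ else _).
by apply/eqP/eqP => [<-|->]; rewrite ?mulgKV ?mulgK.
Qed.

Lemma ind_act_subproof z : @ind_rel j z -> span (@ind_rel j) (shift_fun z).
Proof.
move=> [n [h [g ->]]]; apply: span_gen; exists n, h, (g * y)%g.
by rewrite linearB /= !shift_delta mulgA.
Qed.

Definition ind_act : {linear ind_car j -> ind_car j} :=
  lqmap (f := shift_fun) ind_act_subproof.
End Shift.

Lemma ind_one j x : ind_act j 1%g x = x.
Proof.
rewrite -[x]lqreprK lqmapE; congr lq; apply/ffunP => y.
by rewrite ffunE invg1 mulg1.
Qed.

Lemma ind_mul j g h x : ind_act j (g * h)%g x = ind_act j h (ind_act j g x).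
Proof.
have E s w : ind_act j s (lq _ w) = lq _ (shift_fun s w) by apply: lqmapE.
rewrite -[x]lqreprK (E g) !E; congr lq; apply/ffunP => y.
by rewrite !ffunE invMg mulgA.
Qed.

Definition gind : gmod K gT := Gmod ind_one ind_mul.
End Induction.

(* S^{(n-1,1)} for n = #|U|: the vectors of coordinate sum zero in the
   permutation module K^U (zero when n = 1). *)
Section Standard.
Variable U : finType.

Definition coord_sum (f : {ffun U -> K^o}) : K^o := \sum_x f x.

Lemma coord_sum_is_linear : linear coord_sum.
Proof.
move=> a f g; rewrite /coord_sum scaler_sumr -big_split /=.
by apply: eq_bigr => x _; rewrite !ffunE.
Qed.

HB.instance Definition _ := GRing.isLinear.Build K {ffun U -> K^o} K^o *:%R
  coord_sum coord_sum_is_linear.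

Definition stdrep : lmodType K := ker coord_sum.

Section Act.
Variable s : {perm U}.

(* e_x is sent to e_(s x). *)
Definition std_act_ffun (f : {ffun U -> K^o}) : {ffun U -> K^o} :=
  [ffun x => f (s^-1 x)%g].

Lemma std_act_subproof (f : stdrep) : std_act_ffun (val f) \in kerp coord_sum.
Proof.
change (\sum_x std_act_ffun (val f) x == 0).
rewrite (reindex_inj (@perm_inj _ s)) /=.
under eq_bigr do rewrite ffunE permK.
exact: (valP f).
Qed.

Definition std_act_fun (f : stdrep) : stdrep := Ker (std_act_subproof f).

Lemma std_act_is_linear : linear std_act_fun.
Proof. by move=> a f g; apply: val_inj; apply/ffunP => x; rewrite !ffunE. Qed.

HB.instance Definition _ :=
  GRing.isLinear.Build K stdrep stdrep *:%R std_act_fun std_act_is_linear.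

Definition std_act : {linear stdrep -> stdrep} := std_act_fun.
End Act.

Lemma std_one f : std_act 1%g f = f.
Proof. by apply: val_inj; apply/ffunP => x; rewrite ffunE invg1 perm1. Qed.

Lemma std_mul s t f : std_act (s * t)%g f = std_act t (std_act s f).
Proof. by apply: val_inj; apply/ffunP => x; rewrite !ffunE invMg permM. Qed.

Definition Lact (k : nat) (s : {perm U}) : {linear ext k stdrep -> ext k stdrep} :=
  ext_map k (std_act s).

Lemma Lact_one k x : Lact k 1%g x = x.
Proof.
apply: (ext_ext (G := idfun)) => w; rewrite ext_mapE /=; congr (lq _ (pure _)).
by apply/ffunP => i; rewrite ffunE std_one.
Qed.

Lemma Lact_mul k s t x : Lact k (s * t)%g x = Lact k t (Lact k s x).
Proof.
apply: (ext_ext (G := Lact k t \o Lact k s)) => w.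
rewrite /= !ext_mapE; congr (lq _ (pure _)).
by apply/ffunP => i; rewrite !ffunE std_mul.
Qed.

(* The module L_n, n = #|U|; the exterior powers of degree k >= n vanish. *)
Definition Lmod : gmod K {perm U} := Gmod Lact_one Lact_mul.
End Standard.

(* The module M_T, as a function of the set [P] of vertex sets of the components of T. *)
Section Frobenius.
Variables (V : finType) (P : {set {set V}}).

(* S_{B_1} x ... x S_{B_r} inside S_V. *)
Definition Young : {group {perm V}} := (\bigcap_(B in P) 'N(B | 'P))%G.

Definition block : finType := {B : {set V} | B \in P}.
Definition points (B : block) : finType := {x : V | x \in val B}.

Lemma Young_stab (s : subg_of Young) (B : block) (x : points B) :
  sgval s (val x) \in val B.
Proof.
have /bigcapP/(_ _ (valP B)) sN := valP s.
by have := astabs_act (val x) sN; rewrite /= apermE => ->; apply: (valP x).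
Qed.

Definition block_fun (s : subg_of Young) B (x : points B) : points B :=
  Sub (sgval s (val x)) (Young_stab s x).

Lemma block_fun_inj s B : injective (@block_fun s B).
Proof. by move=> x y /(congr1 val) /= /perm_inj /val_inj. Qed.

Definition block_perm B (s : subg_of Young) : {perm (points B)} :=
  perm (@block_fun_inj s B).

Lemma block_permM B :
  {in [set: subg_of Young] &, {morph block_perm B : s t / (s * t)%g}}.
Proof.
move=> s t _ _; apply/permP => x; apply: val_inj.
by rewrite permM !permE /= permM.
Qed.

Canonical block_morphism B := Morphism (@block_permM B).

Definition Mmod : gmod K {perm V} :=
  gind (gtens (fun B : block => gres (block_morphism B) (Lmod (points B)))).
End Frobenius.

End GradedModules.

Section KernelQuotient.
Variables (K : fieldType) (gT : finGroupType).

Section GKernel.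
Variables (A B : gmod K gT) (d : ghom A B).

Lemma gker_subproof j g (x : ker (d j)) : gact A j g (val x) \in kerp (d j).
Proof.
change (d j (gact A j g (val x)) == 0).
by rewrite ghom_act (eqP (valP x : d j (val x) == 0)) linear0.
Qed.

Definition gker_act_fun j g (x : ker (d j)) : ker (d j) := Ker (gker_subproof g x).

Lemma gker_act_is_linear j g : linear (@gker_act_fun j g).
Proof. by move=> a x y; apply: val_inj; rewrite /= linearP. Qed.

HB.instance Definition _ j g := GRing.isLinear.Build K (ker (d j)) (ker (d j)) *:%R
  (@gker_act_fun j g) (@gker_act_is_linear j g).

Definition gker_act j g : {linear ker (d j) -> ker (d j)} := @gker_act_fun j g.

Lemma gker_one j x : gker_act j 1%g x = x.
Proof. by apply: val_inj; rewrite /= gact_one. Qed.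

Lemma gker_mul j g h x : gker_act j (g * h)%g x = gker_act j h (gker_act j g x).
Proof. by apply: val_inj; rewrite /= gact_mul. Qed.

Definition gker : gmod K gT := @Gmod K gT (fun j => ker (d j)) _ gker_one gker_mul.
End GKernel.

Section GQuotient.
Variables (A : gmod K gT) (P : forall j, A j -> Prop).
Hypothesis Pact : forall j g x, P x -> P (gact A j g x).

Lemma gquot_subproof j g x : P x -> span (@P j) (gact A j g x).
Proof. by move=> /Pact Px; apply: span_gen. Qed.

Definition gquot_act j g : {linear lquot (@P j) -> lquot (@P j)} :=
  lqmap (@gquot_subproof j g).

Lemma gquot_actE j g w : gquot_act j g (lq _ w) = lq _ (gact A j g w).
Proof. exact: lqmapE. Qed.

Lemma gquot_one j x : gquot_act j 1%g x = x.
Proof. by rewrite -[x]lqreprK gquot_actE gact_one. Qed.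

Lemma gquot_mul j g h x : gquot_act j (g * h)%g x = gquot_act j h (gquot_act j g x).
Proof. by rewrite -[x]lqreprK (gquot_actE g) !gquot_actE gact_mul. Qed.

Definition gquot : gmod K gT := Gmod gquot_one gquot_mul.
End GQuotient.

Section GSum.
Variables (I : finType) (A : I -> gmod K gT).

Definition gsum_act j g : {linear dsum (fun i => A i j) -> dsum (fun i => A i j)} :=
  dsum_map (fun i => gact (A i) j g).

Lemma gsum_one j x : gsum_act j 1%g x = x.
Proof. by apply/ffunP => i; rewrite ffunE gact_one. Qed.

Lemma gsum_mul j g h x : gsum_act j (g * h)%g x = gsum_act j h (gsum_act j g x).
Proof. by apply/ffunP => i; rewrite !ffunE gact_mul. Qed.

Definition gsum : gmod K gT := Gmod gsum_one gsum_mul.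
End GSum.

End KernelQuotient.

(** ** Functors on the Boolean lattice 2^E and their cohomology *)

(* A functor from the poset 2^E to graded modules, with object map [A]. *)
Record cube_functor (K : fieldType) (gT : finGroupType) (E : finType)
    (A : {set E} -> gmod K gT) := CubeFunctor {
  mor : forall T T' : {set E}, T \subset T' -> ghom (A T) (A T');
  mor_id : forall (T : {set E}) (h : T \subset T) j x, mor h j x = x;
  mor_comp : forall (T T' T'' : {set E}) (h : T \subset T') (h' : T' \subset T'')
    (h'' : T \subset T'') j x, mor h'' j x = mor h' j (mor h j x) }.

Section Cohomology.
Variables (K : fieldType) (gT : finGroupType) (E : finType).
Variables (A : {set E} -> gmod K gT) (F : cube_functor A).
Variables (m : nat) (lab : E -> 'I_m) (Q : {set {set E}}).

Definition cell (k : nat) : finType := {T : {set E} | (T \in Q) && (#|T| == k)}.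

Definition cochain (k : nat) : gmod K gT := gsum (fun T : cell k => A (val T)).

Definition csign (T : {set E}) (e : E) : K :=
  (-1) ^+ #|[set f in T | (lab f < lab e)%N]|.

(* [mor F] with its inclusion proof recovered; 0 when T is not included in T'. *)
Definition mor0 (T T' : {set E}) j (x : A T j) : A T' j :=
  if decP (@idP (T \subset T')) is left h then mor F h j x else 0.

(* The differential is [diff k k.+1]; the sum is empty if l <> k.+1. *)
Definition diff_fun k l j (f : cochain k j) : cochain l j :=
  [ffun T' : cell l => \sum_(T : cell k)
     \sum_(e | (e \notin val T) && (val T' == e |: val T))
        csign (val T) e *: mor0 (val T') (f T)].

Lemma mor0_is_linear T T' j : linear (@mor0 T T' j).
Proof.
move=> a x y; rewrite /mor0; case: decP => h; first by rewrite linearP.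
by rewrite scaler0 addr0.
Qed.

Lemma mor0_act T T' j g x :
  mor0 T' (gact (A T) j g x) = gact (A T') j g (mor0 T' x).
Proof. by rewrite /mor0; case: decP => h; rewrite ?ghom_act ?linear0. Qed.

Lemma diff_is_linear k l j : linear (@diff_fun k l j).
Proof.
move=> a f g; apply/ffunP => T'; rewrite dsumDE dsumZE !ffunE.
rewrite scaler_sumr -big_split; apply: eq_bigr => T _ /=.
rewrite scaler_sumr -big_split; apply: eq_bigr => e _ /=.
by rewrite dsumDE dsumZE mor0_is_linear scalerDr !scalerA mulrC.
Qed.

HB.instance Definition _ k l j := GRing.isLinear.Build K (cochain k j) (cochain l j)
  *:%R (@diff_fun k l j) (@diff_is_linear k l j).

Lemma diff_act k l j g x :
  @diff_fun k l j (gact (cochain k) j g x) = gact (cochain l) j g (diff_fun l x).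
Proof.
apply/ffunP => T'; rewrite !ffunE linear_sum; apply: eq_bigr => T _.
rewrite linear_sum; apply: eq_bigr => e _.
by rewrite ffunE mor0_act linearZ.
Qed.

Definition diff k l : ghom (cochain k) (cochain l) :=
  @Ghom K gT (cochain k) (cochain l) (fun j => @diff_fun k l j) (@diff_act k l).

Definition cocycles (k : nat) : gmod K gT := gker (diff k k.+1).

Definition coboundary k j (z : cocycles k j) : Prop :=
  exists k' (y : cochain k' j), k'.+1 = k /\ kval z = diff k' k j y.

Lemma coboundary_act k j g z : coboundary z -> coboundary (gact (cocycles k) j g z).
Proof.
move=> [k' [y [kE zE]]]; exists k', (gact _ j g y); split=> //.
by rewrite ghom_act -zE.
Qed.

(* H^k(F|_Q) *)
Definition cohom (k : nat) : gmod K gT := gquot (@coboundary_act k).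

End Cohomology.

(** ** Graphs *)

Record graph (V : finType) := Graph {
  edges : {set {set V}};
  edges2 : forall e, e \in edges -> #|e| = 2 }.

Section Graphs.
Variables (V : finType) (G : graph V).

Definition edge : finType := {e : {set V} | e \in edges G}.

(* [next s] is cyclic; the pairs {x, next s x} are edges since they are the
   elements of C. *)
Definition is_cycle (C : {set edge}) : Prop :=
  exists s : seq V, [/\ (2 < size s)%N, uniq s
    & [set val e | e in C] = [set [set x; next s x] | x in s]].

(* The edge order is given by a bijective [lab : edge -> 'I_m]: the edge written
   e_i, 1 <= i <= m, is the one with lab e = i - 1. *)
Definition broken_circuit m (lab : edge -> 'I_m) (D : {set edge}) : Prop :=
  exists C e, [/\ is_cycle C, e \in C,
    forall f, f \in C -> (lab f <= lab e)%N & D = C :\ e].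

Definition NBC m (lab : edge -> 'I_m) : {set {set edge}} :=
  [set S : {set edge} | `[< forall D, broken_circuit lab D -> ~~ (D \subset S) >]].

Definition adj (T : {set edge}) : rel V :=
  fun x y => [exists e in T, val e == [set x; y]].

Definition comps (T : {set edge}) : {set {set V}} :=
  equivalence_partition (connect (adj T)) [set: V].

Definition completes_cycle (T : {set edge}) (e : edge) : Prop :=
  e \notin T /\ exists C, [/\ is_cycle C, e \in C & C \subset e |: T].

Lemma adj_sym T : symmetric (adj T).
Proof. by move=> x y; apply: eq_existsb => e; rewrite setUC. Qed.

Lemma comps_completes T e : completes_cycle T e -> comps T = comps (e |: T).
Proof.
case=> eNT [C [[s [s2 us Cs]] eC CT]].
have [x xs ex] : exists2 x, x \in s & val e = [set x; next s x].
  have : val e \in [set val e | e in C] by apply: imset_f.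
  by rewrite Cs => /imsetP.
have step z : z \in s -> z != x -> adj T z (next s z).
  move=> zs zx.
  have : [set z; next s z] \in [set [set x; next s x] | x in s] by apply: imset_f.
  rewrite -Cs => /imsetP [f fC fz]; apply/existsP; exists f; rewrite fz eqxx andbT.
  have /setU1P [fe|//] := subsetP CT f fC.
  have E : [set z; next s z] = [set x; next s x] by rewrite fz fe.
  have zn : z = next s x.
    have : z \in [set x; next s x] by rewrite -E set21.
    by rewrite in_set2 (negPf zx) => /eqP.
  have nx : next s z = x.
    have : x \in [set z; next s z] by rewrite E set21.
    by rewrite in_set2 eq_sym (negPf zx) => /eqP.
  exfalso; move: nx zn; case: (rot_to xs) => i s' sE.
  rewrite -!(next_rot i us) sE.
  have us' : uniq (x :: s') by rewrite -sE rot_uniq.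
  have : (2 < size (x :: s'))%N by rewrite -sE size_rot.
  case: s' us' {sE} => [|y [|w s']] //= /and3P [xN yN _] _.
  move=> /[swap]; rewrite eqxx => ->; rewrite eqxx.
  move: xN; rewrite !inE !negb_or => /and3P [xy xw _].
  by rewrite eq_sym (negPf xy) => /eqP; rewrite eq_sym (negPf xw).
have conn : connect (adj T) (next s x) x.
  case: (rot_to xs) => i s' sE.
  have us' : uniq (x :: s') by rewrite -sE rot_uniq.
  have ns z : next s z = next (x :: s') z by rewrite -sE next_rot.
  have ms z : (z \in s) = (z \in x :: s') by rewrite -sE mem_rot.
  have := cycle_next us'; case: s' us' ns ms {sE} => [|y s'] us' ns ms.
    by rewrite ns /= eqxx.
  rewrite (cycle_path x) /= -/(next (x :: y :: s')) => /and3P [/eqP nlast0 _ Hp].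
  have all_s' : all (fun z => (z \in s) && (z != x)) (y :: s').
    apply/allP => z zs'; rewrite ms inE zs' orbT /=.
    by apply: contraTneq zs' => ->; case/andP: us'.
  have last_s' : last y s' \in y :: s' by apply: mem_last.
  have /andP [lasts lastx] := allP all_s' _ last_s'.
  have nlast : next s (last y s') = x.
    by rewrite ns.
  have cl : connect (adj T) y (last y s').
    apply/connectP; exists s' => //.
    apply: (sub_in_path (P := fun z => (z \in s) && (z != x)) _ all_s' Hp).
    move=> a b /andP [as_ ax] _ /eqP <-; rewrite -ns; exact: step.
  have -> : next s x = y by rewrite ns /= eqxx.
  apply: connect_trans cl (connect1 _); rewrite -[X in adj _ _ X]nlast.
  exact: step.
have symT := sym_connect_sym (adj_sym T).
suff E : connect (adj T) =2 connect (adj (e |: T)).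
  rewrite /comps /equivalence_partition; apply: eq_imset => a.
  by apply/setP => b; rewrite !inE E.
move=> a b; apply/idP/idP; apply: connect_sub => {a b} a b.
  case/existsP => f /andP [fT fE]; apply: connect1; apply/existsP; exists f.
  by rewrite inE fT orbT.
case/existsP => f /andP [/setU1P [->|fT] fE]; last first.
  by apply: connect1; apply/existsP; exists f; rewrite fT.
have : [set x; next s x] = [set a; b] by rewrite -ex; apply/eqP.
move=> ab; have : a \in [set x; next s x] by rewrite ab set21.
have : b \in [set x; next s x] by rewrite ab set22.
rewrite !in_set2 => /orP [] /eqP -> /orP [] /eqP -> //; try exact: connect0.
by rewrite symT.
Qed.

End Graphs.

(** ** Chromatic symmetric functors *)

Section Chromatic.
Variables (K : fieldType) (V : finType) (G : graph V).

Definition CSobj (T : {set edge G}) : gmod K {perm V} := Mmod K (comps T).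

(* The identity of M_P, typed along an equality of vertex partitions. *)
Definition Mid (P P' : {set {set V}}) (eP : P = P') : ghom (Mmod K P) (Mmod K P') :=
  match eP with erefl => gid (Mmod K P) end.

(* Nothing is imposed on the maps for edges joining two components, besides
   functoriality. *)
Definition chromatic_functor (F : cube_functor CSobj) : Prop :=
  forall (T : {set edge G}) (e : edge G) (ce : completes_cycle T e)
    (h : T \subset e |: T) j x,
  mor F h j x = Mid (comps_completes ce) j x.

End Chromatic.

(* Main.v *)
(** For a set [S] of edges, say that [e] is spanned by [S] if the edges of [S]
    with labels smaller than that of [e] connect its endpoints; [S] contains a
    broken circuit exactly when it spans some edge.  Let [p S] be the spanned
    edge with the largest label.  Replacing a path through [p S] by the detour
    that spans [p S] shows that [p] does not change when [p S] is added to or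
    removed from [S].  So the sets outside NBC are matched in pairs [T],
    [e |: T] with [p T = e]; adding [e] completes a cycle, and the functor is
    an isomorphism on each pair.  The label of [p] is monotone in [S], hence the
    pairs can be eliminated one label at a time and the cochains supported
    outside NBC form an acyclic subcomplex.  It is the kernel of the restriction
    of cochains to NBC, which is therefore an isomorphism in cohomology. *)

From HB Require Import structures.
From mathcomp Require Import all_boot all_order all_algebra all_fingroup.
From mathcomp Require Import boolp reals complex.
(* Required last: MathComp also has a [span] and a [gact]. *)
Require Import Defs.

Set Implicit Arguments.
Unset Strict Implicit.
Unset Printing Implicit Defensive.

Import GRing.Theory.
Local Open Scope ring_scope.

(** * The cube differential on families *)

Section Families.
Variables (K : fieldType) (gT : finGroupType) (E : finType).
Variables (A : {set E} -> gmod K gT) (F : cube_functor A).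
Variables (m : nat) (lab : E -> 'I_m).
Hypothesis lab_inj : injective lab.

Local Notation csign := (csign K lab).

(* Cochains are handled as families indexed by all sets [T], of all sizes at
   once, rather than by the subtype [cell Q k]; [dfam] is the differential of
   the whole cube. *)
Definition dfam j (f : forall T, A T j) : forall T, A T j :=
  fun T => \sum_(e in T) csign (T :\ e) e *: mor0 F T (f (T :\ e)).

Lemma mor0_lin (T T' : {set E}) j (a : K) (x y : A T j) :
  mor0 F T' (a *: x + y) = a *: mor0 F T' x + mor0 F T' y.
Proof. exact: mor0_is_linear. Qed.

Lemma mor00 (T T' : {set E}) j : mor0 F T' (0 : A T j) = 0.
Proof. by rewrite /mor0; case: decP => h; rewrite ?linear0. Qed.

Lemma mor0E (T T' : {set E}) (h : T \subset T') j (x : A T j) : mor0 F T' x = mor F h j x.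
Proof.
by rewrite /mor0; case: decP => // h'; rewrite (bool_irrelevance h' h).
Qed.

Lemma dfam_lin j (a : K) (f g : forall T, A T j) (T : {set E}) :
  dfam (fun T => a *: f T + g T) T = a *: dfam f T + dfam g T.
Proof.
rewrite /dfam scaler_sumr -big_split; apply: eq_bigr => e _ /=.
by rewrite mor0_lin scalerDr !scalerA mulrC.
Qed.

Lemma dfamB j (f g : forall T, A T j) (T : {set E}) :
  dfam (fun T => f T - g T) T = dfam f T - dfam g T.
Proof.
have -> : (fun T => f T - g T) = (fun T => -1 *: g T + f T).
  by apply: functional_extensionality_dep => S; rewrite scaleN1r addrC.
by rewrite dfam_lin scaleN1r addrC.
Qed.

Lemma dfamD j (f g : forall T, A T j) (T : {set E}) :
  dfam (fun T => f T + g T) T = dfam f T + dfam g T.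
Proof.
have -> : (fun T => f T + g T) = (fun T => 1 *: f T + g T).
  by apply: functional_extensionality_dep => S; rewrite scale1r.
by rewrite dfam_lin scale1r.
Qed.

Lemma eq_dfam j (f g : forall T, A T j) (T : {set E}) :
  (forall e, e \in T -> f (T :\ e) = g (T :\ e)) -> dfam f T = dfam g T.
Proof. by move=> fg; apply: eq_bigr => e eT; rewrite fg. Qed.

Lemma dfam0 j (T : {set E}) : dfam (fun T => 0 : A T j) T = 0.
Proof. by apply: big1 => e _; rewrite mor00 scaler0. Qed.

(** Removing the larger edge [e'] leaves the count below [e] unchanged, while removing [e] lowers
    the count below [e'] by one; this produces the single sign. *)
Lemma csign_swap (T : {set E}) e e' : e \in T -> e' \in T -> (lab e < lab e')%N ->
  csign (T :\ e) e * csign (T :\ e :\ e') e' =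
  - (csign (T :\ e') e' * csign (T :\ e' :\ e) e).
Proof.
move=> eT e'T lt.
have ne : e != e' by apply: contraTneq lt => ->; rewrite ltnn.
rewrite /Defs.csign.
have -> : [set f in T :\ e | (lab f < lab e)%N] =
    [set f in T :\ e' :\ e | (lab f < lab e)%N].
  apply/setP => f; rewrite !inE; case: (f =P e') => [->|] //=.
  by rewrite [X in _ && X]ltnNge (ltnW lt) !andbF.
have -> : [set f in T :\ e' | (lab f < lab e')%N] =
    e |: [set f in T :\ e :\ e' | (lab f < lab e')%N].
  apply/setP => f; rewrite !inE; case: (f =P e) => [->|] //=.
  by rewrite ne eT.
by rewrite cardsU1 !inE eqxx /= andbF /= exprS mulN1r mulNr opprK mulrC.
Qed.

(** Two edges can be removed in either order: functoriality gives the same map, and [csign_swap]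
    gives opposite signs. *)
Lemma dfam_dfam j (f : forall T, A T j) (T : {set E}) : dfam (dfam f) T = 0.
Proof.
pose G e e' := (csign (T :\ e) e * csign (T :\ e :\ e') e') *:
  mor0 F T (f (T :\ e :\ e')).
have -> : dfam (dfam f) T =
   \sum_(e in T) \sum_(e' in T | e' != e) G e e'.
  apply: eq_bigr => e eT.
  rewrite (mor0E (subD1set T e)) linear_sum scaler_sumr.
  apply: eq_big => [e'|e' e'T]; first by rewrite !inE andbC.
  rewrite linearZ scalerA; congr (_ *: _).
  have sub := subset_trans (subD1set (T :\ e) e') (subD1set T e).
  by rewrite (mor0E (subD1set _ _)) -(mor_comp F _ _ sub) -mor0E.
have split e : e \in T -> \sum_(e' in T | e' != e) G e e' =
  \sum_(e' in T | (lab e < lab e')%N) G e e' + \sum_(e' in T | (lab e' < lab e)%N) G e e'.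
  move=> eT; rewrite (bigID (fun e' => (lab e < lab e')%N)) /=.
  congr (_ + _); apply: eq_bigl => e'.
    by case: (e' =P e) => [->|] //=; rewrite ?ltnn ?andbF ?andbT.
  rewrite -leqNgt leq_eqVlt -andbA; congr (_ && _).
  case: (e' =P e) => [->|ne] /=; first by rewrite ltnn.
  by case: eqP => // /val_inj/lab_inj.
rewrite (eq_bigr _ split) big_split /=.
(* Exchanging the sums in the second half lets the pair [(e', e)] meet [(e, e')], so that the terms
   cancel one by one. *)
rewrite [X in _ + X](exchange_big_dep (fun e => e \in T)) /=; last first.
  by move=> e e' _ /andP [].
rewrite -big_split big1 // => e eT /=; rewrite eT /=.
rewrite -big_split big1 // => e' /andP [e'T lt] /=.
rewrite /G csign_swap // scaleNr.
have -> : T :\ e :\ e' = T :\ e' :\ e by rewrite !setDDl setUC.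
by rewrite addNr.
Qed.

Lemma csign_neq0 (T : {set E}) e : csign T e != 0.
Proof. by rewrite /Defs.csign signr_eq0. Qed.

(** * Acyclicity of the matched part *)

Section Acyclic.
Variable p : {set E} -> option E.
(** The shift by one reserves rank 0 for the unmatched sets. *)
Definition prank T := if p T is Some e then (lab e).+1 else 0%N.

Hypothesis p_add : forall T e, p T = Some e -> p (e |: T) = Some e.
Hypothesis p_del : forall T e, p T = Some e -> p (T :\ e) = Some e.
Hypothesis p_mono : forall T T' : {set E}, T \subset T' -> (prank T <= prank T')%N.
Hypothesis p_iso : forall (T : {set E}) e (h : T \subset e |: T) j,
  p T = Some e -> e \notin T -> bijective (mor F h j).

Lemma acyclic j (f : forall T, A T j) :
  (forall T, p T = None -> f T = 0) -> (forall T, dfam f T = 0) ->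
  exists h : forall T, A T j,
    (forall T, p T = None -> h T = 0) /\ (forall T, dfam h T = f T).
Proof.
move=> f0.
(* Closed families vanishing where [prank] is at most [a] are treated by
   induction on [m - a]: the sets of rank [a.+1] are cleared by subtracting the
   differential of a family [h] supported on the sets of rank [a.+1] that do
   not contain the edge [p] selects. *)
suff main d a : forall g : forall T, A T j, (m <= a + d)%N ->
    (forall T, (prank T <= a)%N -> g T = 0) -> (forall T, dfam g T = 0) ->
    exists h : forall T, A T j,
      (forall T, p T = None -> h T = 0) /\ (forall T, dfam h T = g T).
  apply: (main m 0%N) => // T rT; apply: f0.
  by move: rT; rewrite /prank; case: (p T).
elim: d a => [|d IH] a g ma ga dg.
  (* Here [m <= a], and no rank exceeds [m], so [g] is zero. *)
  exists (fun T => 0); split=> // T; rewrite dfam0 ga //.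
  rewrite addn0 in ma; apply: leq_trans ma; rewrite /prank.
  by case: (p T).
(* The value of [h] at [T]: on the lower set of a pair of rank [a.+1], the map of the pair is
   inverted to hit [g (e |: T)]; elsewhere the value is 0. *)
have /(_ _)/cid pre T : exists y : A T j,
    (forall e, p T = Some e -> e \notin T -> prank T = a.+1 ->
       csign T e *: mor0 F (e |: T) y = g (e |: T)) /\
    (prank T = a.+1 -> (exists2 e, p T = Some e & e \notin T) \/ y = 0) /\
    (prank T <> a.+1 -> y = 0).
  case pT : (p T) => [e|]; last first.
    by exists 0; split=> //; split=> //; right.
  case eT : (e \in T).
    by exists 0; split=> [_ [<-]|]; [rewrite eT | split=> //; right].
  have [rT|rT] := pselect (prank T = a.+1); last by exists 0; split.
  have [inv _ invK] := p_iso (subsetU1 e T) j pT (negbT eT).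
  exists (inv ((csign T e)^-1 *: g (e |: T))); split=> [_ [<-] _ _|].
    by rewrite (mor0E (subsetU1 e T)) invK scalerA divff ?scale1r // csign_neq0.
  by split=> // _; left; exists e => //; rewrite eT.
pose h T := projT1 (pre T).
have hE (T : {set E}) e : p T = Some e -> e \notin T -> prank T = a.+1 ->
    csign T e *: mor0 F (e |: T) (h T) = g (e |: T).
  by have [? _] := projT2 (pre T); auto.
have h0 T : prank T <> a.+1 -> h T = 0.
  by have [_ [_ ?]] := projT2 (pre T); auto.
have h0in (T : {set E}) e : p T = Some e -> e \in T -> h T = 0.
  move=> pT eT; have [/[dup] rT|/h0 //] := pselect (prank T = a.+1).
  have [_ [H _]] := projT2 (pre T) => /H [[e']|//].
  by rewrite pT => -[<-]; rewrite eT.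
pose g' T := g T - dfam h T.
(* By [p_mono], subsets of [T] also have rank at most [a], where [h] vanishes. *)
have g'le T : (prank T <= a)%N -> g' T = 0.
  move=> rT; rewrite /g' ga // sub0r /dfam big1 ?oppr0 // => e _.
  rewrite h0 ?mor00 ?scaler0 // => r.
  by have := leq_trans (p_mono (subD1set T e)) rT; rewrite r ltnn.
have rankI (T T' : {set E}) e : p T = Some e -> T' \subset T ->
    prank T' = prank T -> p T' = Some e.
  move=> pT sT; rewrite /prank pT; case: (p T') => // e' [] /val_inj/lab_inj ->.
  by [].
(* Only the removal of [e] contributes to [dfam h T], and by [hE] it contributes [g T]. Any other
   [T :\ e'] of rank [a.+1] still selects and contains [e], so [h] vanishes on it. *)
have g'in (T : {set E}) e : prank T = a.+1 -> p T = Some e -> e \in T -> g' T = 0.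
  move=> rT pT eT; rewrite /g' /dfam (bigD1 e) //=.
  have pD := p_del pT.
  have := hE _ _ pD; rewrite setD1K // => ->; last 2 first.
  - by rewrite !inE eqxx.
  - by move: rT; rewrite /prank pT pD.
  rewrite big1 ?addr0 ?subrr // => e' /andP [e'T ne].
  have [r|/h0 ->] := pselect (prank (T :\ e') = a.+1); last by rewrite mor00 scaler0.
  rewrite (h0in _ e) ?mor00 ?scaler0 //.
    by apply: rankI pT (subD1set _ _) _; rewrite rT.
  by rewrite !inE eq_sym ne.
have dg' T : dfam g' T = 0 by rewrite dfamB dg dfam_dfam subr0.
have [] := IH a.+1 g'; rewrite ?addSnnS //.
  move=> T; rewrite leq_eqVlt => /orP [/eqP rT|]; last exact: g'le.
  case pT : (p T) => [e|]; last by move: rT; rewrite /prank pT.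
  case eT : (e \in T); first exact: g'in rT pT eT.
  (* For a lower set [T], closedness of [g'] is read at [e |: T]. The other faces have rank at most
     [a] or are upper sets of rank [a.+1], so the invertible map of the pair alone sends [g' T] to
     0. *)
  have := dg' (e |: T); rewrite /dfam (bigD1 e) ?setU11 //= setU1K ?eT // big1.
    rewrite addr0 => /eqP; rewrite scaler_eq0 (negPf (csign_neq0 _ _)) /=.
    rewrite (mor0E (subsetU1 e T)) => /eqP E0.
    apply: (bij_inj (p_iso (subsetU1 e T) j pT (negbT eT))).
    by rewrite E0 linear0.
  move=> e' /andP [e'T ne].
  have pU := p_add pT; have sU := subD1set (e |: T) e'.
  have := p_mono sU; rewrite {2}/prank pU.
  have -> : (lab e).+1 = a.+1 by rewrite -rT /prank pT.
  rewrite leq_eqVlt => /orP [/eqP r|/g'le ->]; last by rewrite mor00 scaler0.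
  rewrite (g'in _ e r) ?mor00 ?scaler0 //.
    by apply: (rankI _ _ _ pU sU); rewrite r -rT /prank pT pU.
  by rewrite !inE eqxx eq_sym ne.
move=> k [k0 dk]; exists (fun T => h T + k T); split=> T; last first.
  by rewrite dfamD dk /g' addrC subrK.
by move=> pT; rewrite k0 // h0 ?addr0 // /prank pT.
Qed.

End Acyclic.
End Families.

(** * Cochains on an order ideal as families *)

Section CochainFamilies.
Variables (K : fieldType) (gT : finGroupType) (E : finType).
Variables (A : {set E} -> gmod K gT) (F : cube_functor A).
Variables (m : nat) (lab : E -> 'I_m).
Variable Q : {set {set E}}.
Hypothesis Q_ideal : forall T T' : {set E}, T \subset T' -> T' \in Q -> T \in Q.

Local Notation dfam := (dfam F lab).

Definition fam_of k j (f : cochain A Q k j) : forall T, A T j := fun T =>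
  if decP (@idP ((T \in Q) && (#|T| == k))) is left h then f (exist _ T h) else 0.

Lemma fam_ofE k j (f : cochain A Q k j) (T : cell Q k) : fam_of f (val T) = f T.
Proof.
case: T => T h; rewrite /fam_of /=; case: decP => // h'.
by rewrite (bool_irrelevance h' h).
Qed.

Lemma fam_of0 k j (f : cochain A Q k j) (T : {set E}) :
  ~~ ((T \in Q) && (#|T| == k)) -> fam_of f T = 0.
Proof. by rewrite /fam_of => /negP nh; case: decP. Qed.

Definition trunc k j (f : forall T, A T j) : cochain A Q k j :=
  [ffun T : cell Q k => f (val T)].

Lemma fam_of_trunc k j (f : forall T, A T j) (T : {set E}) :
  (T \in Q) && (#|T| == k) -> fam_of (trunc k f) T = f T.
Proof. by move=> h; rewrite (fam_ofE _ (exist _ T h)) ffunE. Qed.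

Lemma cell_D1 k (T : cell Q k.+1) e : e \in val T ->
  (val T :\ e \in Q) && (#|val T :\ e| == k).
Proof.
move=> eT; have /andP [TQ cT] := valP T.
rewrite (Q_ideal (subD1set _ e) TQ) /=.
by move: cT; rewrite (cardsD1 e) eT.
Qed.

(** Every [val T :\ e] is again a cell because [Q] is an ideal, so the sum over cells and edges
    collapses to one over the edges of [T]. *)
Lemma diffE k j (f : cochain A Q k j) (T : cell Q k.+1) :
  diff F lab Q k k.+1 j f T = dfam (fam_of f) (val T).
Proof.
rewrite ffunE /dfam.
rewrite (exchange_big_dep (fun e => e \in val T)) /=; last first.
  by move=> S e _ /andP [_ /eqP ->]; rewrite setU11.
apply: eq_bigr => e eT.
have h := cell_D1 eT.
rewrite (big_pred1 (exist _ (val T :\ e) h : cell Q k)) /=.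
  by rewrite -(fam_ofE f (exist _ (val T :\ e) h)).
move=> S; apply/andP/eqP => [[eS /eqP TE]|->].
  by apply: val_inj; rewrite /= TE setU1K.
by rewrite /= !inE eqxx setD1K.
Qed.

Lemma dfam_fam_of0 k j (f : cochain A Q k j) (T : {set E}) :
  #|T| != k.+1 -> dfam (fam_of f) T = 0.
Proof.
move=> cT; apply: big1 => e eT; rewrite fam_of0 ?mor00 ?scaler0 //.
apply: contra cT => /andP [_ /eqP <-].
by rewrite (cardsD1 e T) eT.
Qed.

Lemma cocycle_dfam k j (f : cochain A Q k j) :
  diff F lab Q k k.+1 j f = 0 -> forall T, T \in Q -> dfam (fam_of f) T = 0.
Proof.
move=> df T TQ; have [cT|cT] := boolP (#|T| == k.+1); last exact: dfam_fam_of0.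
have h : (T \in Q) && (#|T| == k.+1) by rewrite TQ.
have := congr1 (fun g : cochain A Q k.+1 j => g (exist _ T h)) df.
by rewrite diffE ffunE.
Qed.

Lemma dfam_cocycle k j (f : cochain A Q k j) :
  (forall T, T \in Q -> dfam (fam_of f) T = 0) -> diff F lab Q k k.+1 j f = 0.
Proof.
move=> df; apply/ffunP => T; rewrite diffE [RHS]ffunE df //.
by have /andP [] := valP T.
Qed.

(** The primitive [f] may be any family: at a set of size [k] the differential reads only sets of
    size one less, so its other values are harmless. *)
Lemma span_coboundaryP k j (z : cocycles F lab Q k j) :
  span (@coboundary _ _ _ _ F _ lab Q k j) z <->
  exists f : forall T, A T j, forall T : cell Q k, kval z T = dfam f (val T).
Proof.
split.
  elim=> [|a u v [k' [y [kE uE]]] _ [f vE]].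
    by exists (fun T => 0) => T; rewrite dfam0 ffunE.
  subst k.
  exists (fun T => a *: fam_of y T + f T) => T.
  by rewrite dfam_lin -vE -diffE -uE dsumDE dsumZE.
case: k z => [|k] z [f zE].
  (* In degree 0 the only possible cell is the empty set, where [dfam] is an empty sum. *)
  suff -> : z = 0 by exact: span0.
  apply: val_inj; apply/ffunP => T; rewrite zE [RHS]ffunE /dfam.
  have /andP [_ /eqP /cards0_eq ->] := valP T.
  by rewrite big_set0.
apply: span_gen; exists k, (trunc k f); split=> //.
apply/ffunP => T; rewrite zE diffE; apply: eq_dfam => e eT.
by rewrite fam_of_trunc ?cell_D1.
Qed.

End CochainFamilies.

(** * Restriction of cochains to an order ideal *)

Section Restriction.
Variables (K : fieldType) (gT : finGroupType) (E : finType).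
Variables (A : {set E} -> gmod K gT) (F : cube_functor A).
Variables (m : nat) (lab : E -> 'I_m).
Variable Q : {set {set E}}.
Hypothesis Q_ideal : forall T T' : {set E}, T \subset T' -> T' \in Q -> T \in Q.

Local Notation dfam := (dfam F lab).
Local Notation full := [set: {set E}].

Lemma full_ideal (T T' : {set E}) : T \subset T' -> T' \in full -> T \in full.
Proof. by rewrite !inE. Qed.

Definition restr k j (f : cochain A full k j) : cochain A Q k j := trunc Q k (fam_of f).

Lemma fam_of_restr k j (f : cochain A full k j) (T : {set E}) :
  T \in Q -> fam_of (restr f) T = fam_of f T.
Proof.
move=> TQ; have [cT|cT] := boolP (#|T| == k).
  by rewrite fam_of_trunc // TQ.
by rewrite !fam_of0 ?(negPf cT) ?andbF.
Qed.

Lemma fam_of_lin (P : {set {set E}}) k j a (f g : cochain A P k j) T :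
  fam_of (a *: f + g) T = a *: fam_of f T + fam_of g T.
Proof. by rewrite /fam_of; case: decP => h; rewrite ?dsumDE ?dsumZE // scaler0 addr0. Qed.

(** The differential at a set of [Q] reads only its subsets, which lie in [Q], so restriction
    preserves closedness. *)
Lemma restr_subproof k j (z : cocycles F lab full k j) :
  restr (kval z) \in kerp (diff F lab Q k k.+1 j).
Proof.
apply/eqP/dfam_cocycle => // T TQ.
rewrite -[RHS](cocycle_dfam full_ideal (eqP (valP z)) (in_setT T)).
apply: eq_dfam => e _; rewrite fam_of_restr //.
exact: Q_ideal (subD1set _ _) TQ.
Qed.

Definition restr_cocycle k j (z : cocycles F lab full k j) : cocycles F lab Q k j :=
  Ker (restr_subproof z).

Lemma restr_cocycle_is_linear k j : linear (@restr_cocycle k j).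
Proof.
move=> a y z; apply: val_inj; apply/ffunP => T.
by rewrite /= dsumDE dsumZE !ffunE /= fam_of_lin.
Qed.

HB.instance Definition _ k j := GRing.isLinear.Build K (cocycles F lab full k j)
  (cocycles F lab Q k j) *:%R (@restr_cocycle k j) (@restr_cocycle_is_linear k j).

Lemma restr_coboundary k j (z : cocycles F lab full k j) :
  coboundary z -> span (@coboundary _ _ _ _ F _ lab Q k j) (restr_cocycle z).
Proof.
move=> /span_gen /(span_coboundaryP full_ideal) [f zE].
apply/span_coboundaryP => //; exists f => T; have /andP [TQ cT] := valP T.
have h : (val T \in full) && (#|val T| == k) by rewrite inE.
by rewrite -(zE (exist _ (val T) h)) /= ffunE -(fam_ofE _ (exist _ (val T) h)).
Qed.

Definition restr_cohom_map k j :
    {linear cohom F lab full k j -> cohom F lab Q k j} :=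
  lqmap (@restr_coboundary k j).

Lemma restr_cohom_act k j g x :
  restr_cohom_map k j (gact (cohom F lab full k) j g x) =
  gact (cohom F lab Q k) j g (restr_cohom_map k j x).
Proof.
rewrite -[x]lqreprK; set z := lqrepr x.
have resE u : restr_cohom_map k j (lq _ u) = lq _ (restr_cocycle u) by apply: lqmapE.
transitivity (restr_cohom_map k j (lq _ (gact (cocycles F lab full k) j g z))).
  by congr (restr_cohom_map k j _); apply: gquot_actE.
rewrite !resE; transitivity (lq (@coboundary _ _ _ _ F _ lab Q k j)
    (gact (cocycles F lab Q k) j g (restr_cocycle z))); last exact/esym/gquot_actE.
congr lq.
apply: val_inj; apply/ffunP => T; rewrite /= !ffunE /= /fam_of.
by case: decP => h; rewrite ?ffunE ?linear0.
Qed.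

Definition restr_cohom k : ghom (cohom F lab full k) (cohom F lab Q k) :=
  Ghom (@restr_cohom_act k).

End Restriction.

(** * From a matching to an isomorphism in cohomology *)

Section Matching.
Variables (K : fieldType) (gT : finGroupType) (E : finType).
Variables (A : {set E} -> gmod K gT) (F : cube_functor A).
Variables (m : nat) (lab : E -> 'I_m).
Hypothesis lab_inj : injective lab.
Variables (p : {set E} -> option E) (Q : {set {set E}}).

Hypothesis QE : forall T, (T \in Q) = (p T == None).
Hypothesis p_add : forall T e, p T = Some e -> p (e |: T) = Some e.
Hypothesis p_del : forall T e, p T = Some e -> p (T :\ e) = Some e.
Hypothesis p_mono : forall T T' : {set E},
  T \subset T' -> (prank lab p T <= prank lab p T')%N.
Hypothesis p_iso : forall (T : {set E}) e (h : T \subset e |: T) j,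
  p T = Some e -> e \notin T -> bijective (mor F h j).

Local Notation dfam := (dfam F lab).
Local Notation full := [set: {set E}].

Lemma unmatched_ideal (T T' : {set E}) : T \subset T' -> T' \in Q -> T \in Q.
Proof.
move=> /p_mono; rewrite !QE /prank.
by case: (p T') => //; case: (p T).
Qed.

(** If [z] restricts to the differential of [g], subtracting the differential of a cut-off of [g]
    leaves a closed family that vanishes on [Q], which [acyclic] integrates. *)
Lemma restr_cohom_inj k j : injective (restr_cohom F lab unmatched_ideal k j).
Proof.
apply: raddf_inj => x; rewrite -[x]lqreprK; set z := lqrepr x.
move=> rz0; have : lq (@coboundary _ _ _ _ F _ lab Q k j)
    (restr_cocycle unmatched_ideal z) = lq _ 0.
  by rewrite linear0 -[RHS]rz0; apply/esym/lqmapE.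
move/lq_eq; rewrite subr0 => /(span_coboundaryP unmatched_ideal) [g gE].
rewrite -[RHS](linear0 (lq _)); apply/lq_eq; rewrite subr0.
apply/(span_coboundaryP (@full_ideal E)).
(* Keeping only sizes one below [k] makes [dfam g'] agree with [z] on all of [Q], including the
   sizes where [fam_of] is 0. *)
pose g' (T : {set E}) : A T j := if (T \in Q) && (#|T|.+1 == k) then g T else 0.
have g'E T : T \in Q -> dfam g' T = fam_of (kval z) T.
  move=> TQ; have [cT|cT] := boolP (#|T| == k).
    have h : (T \in Q) && (#|T| == k) by rewrite TQ.
    have := gE (exist _ T h); rewrite /= ffunE /= => ->.
    apply: eq_dfam => e eT; rewrite /g' (unmatched_ideal (subD1set T e) TQ) /=.
    by move: cT; rewrite (cardsD1 e) eT => ->.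
  rewrite fam_of0 ?inE //; apply: big1 => e eT; rewrite /g'.
  by move: cT; rewrite (cardsD1 e) eT => /negPf ->; rewrite andbF mor00 scaler0.
have [T pT|T|h [_ hE]] := @acyclic _ _ _ _ F _ _ lab_inj _ p_add p_del p_mono p_iso j
    (fun T => fam_of (kval z) T - dfam g' T).
- by rewrite g'E ?subrr // QE pT.
- rewrite dfamB dfam_dfam // subr0.
  by apply: (cocycle_dfam (@full_ideal E) (eqP (valP z))); rewrite inE.
exists (fun T => h T + g' T) => T.
by rewrite dfamD hE subrK fam_ofE.
Qed.

(** Extended by zero, [z] has a closed differential that vanishes on [Q]. By [acyclic] this is the
    differential of some [h] vanishing on [Q], and [z - h] is a cocycle that restricts to [z]. *)
Lemma restr_cohom_surj k j y : exists x, restr_cohom F lab unmatched_ideal k j x = y.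
Proof.
rewrite -[y]lqreprK; set z := lqrepr y.
have dz := cocycle_dfam unmatched_ideal (eqP (valP z)).
have [T pT|T|h [h0 hE]] := @acyclic _ _ _ _ F _ _ lab_inj _ p_add p_del p_mono p_iso j
    (dfam (fam_of (kval z))).
- by rewrite dz // QE pT.
- by rewrite dfam_dfam.
(* The family [h] may have parts of other sizes; truncation to size [k] keeps all that the
   differential at size [k.+1] reads. *)
pose f : cochain A full k j := trunc full k (fun T => fam_of (kval z) T - h T).
have df : f \in kerp (diff F lab full k k.+1 j).
  apply/eqP/(dfam_cocycle (@full_ideal E)) => T _.
  have [cT|cT] := boolP (#|T| == k.+1); last exact: dfam_fam_of0.
  transitivity (dfam (fun T => fam_of (kval z) T - h T) T).
    apply: eq_dfam => e eT; rewrite fam_of_trunc // inE /=.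
    by move: cT; rewrite (cardsD1 e) eT.
  by rewrite dfamB hE subrr.
exists (lq _ (Ker df)); rewrite [LHS]lqmapE; congr lq.
apply: val_inj; apply/ffunP => T; rewrite /= ffunE.
have /andP [TQ cT] := valP T.
rewrite fam_of_trunc ?inE // fam_ofE h0 ?subr0 //.
by apply/eqP; rewrite -QE.
Qed.

Lemma restr_cohom_iso k : gmod_iso (cohom F lab full k) (cohom F lab Q k).
Proof.
exists (restr_cohom F lab unmatched_ideal k) => j.
pose sec y := cid (@restr_cohom_surj k j y).
exists (fun y => projT1 (sec y)) => x; last exact: projT2 (sec x).
by apply: (@restr_cohom_inj k j); apply: projT2 (sec _).
Qed.

End Matching.

(** * Spanned edges and broken circuits *)

Section SpannedEdges.
Variables (V : finType) (G : graph V) (m : nat) (lab : edge G -> 'I_m).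
Hypothesis lab_inj : injective lab.

Implicit Types (S T : {set edge G}) (e f : edge G).

Definition below S e : {set edge G} := [set f in S | (lab f < lab e)%N].

Definition spanned S e : bool :=
  [exists x, exists y, (val e == [set x; y]) && connect (adj (below S e)) x y].

Lemma sub_adj_connect S T : (forall f, f \in S -> f \in T) ->
  subrel (connect (adj S)) (connect (adj T)).
Proof.
move=> ST; apply: connect_sub => x y /existsP [f /andP [fS fE]].
by apply: connect1; apply/existsP; exists f; rewrite ST.
Qed.

Lemma spanned_connect S e x y : spanned S e -> val e = [set x; y] ->
  connect (adj (below S e)) x y.
Proof.
case/existsP => a /existsP [b /andP [/eqP -> ab]] E.
have /set2P xE : x \in [set a; b] by rewrite E set21.
have /set2P yE : y \in [set a; b] by rewrite E set22.
have sym := sym_connect_sym (adj_sym (below S e)).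
by case: xE yE => -> [] -> //; rewrite ?connect0 // sym.
Qed.

Lemma spanned_sub S T e : S \subset T -> spanned S e -> spanned T e.
Proof.
move=> /subsetP ST /existsP [x /existsP [y /andP [ev xy]]].
apply/existsP; exists x; apply/existsP; exists y; rewrite ev /=.
by apply: sub_adj_connect xy => f; rewrite !inE => /andP [/ST -> ->].
Qed.

(** The inequality in [below] is strict, so [e] never helps to span itself. *)
Lemma spanned_D1 S e : spanned S e -> spanned (S :\ e) e.
Proof.
rewrite /spanned; suff -> : below (S :\ e) e = below S e by [].
apply/setP => f; rewrite !inE; case: (f =P e) => [->|] //=.
by rewrite ltnn andbF.
Qed.

(** A step along [e] is replaced by the detour spanning [e], whose labels are below that of [e] and
    hence below that of [f]. *)
Lemma spanned_U1 S e f : spanned S e -> (lab e < lab f)%N ->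
  spanned (e |: S) f -> spanned S f.
Proof.
move=> se ef /existsP [x /existsP [y /andP [fE xy]]].
apply/existsP; exists x; apply/existsP; exists y; rewrite fE /=.
apply: connect_sub xy => a b /existsP [g /andP []].
rewrite !inE => /andP [/predU1P [->|gS] gf] /eqP gE.
  apply: sub_adj_connect (spanned_connect se gE) => g'.
  by rewrite !inE => /andP [-> /ltn_trans ->].
by apply: connect1; apply/existsP; exists g; rewrite !inE gS gf gE /=.
Qed.

Definition top_spanned S : option (edge G) :=
  [pick e | spanned S e && [forall f, spanned S f ==> (lab f <= lab e)%N]].

Lemma top_spannedE S e : top_spanned S = Some e <->
  spanned S e /\ forall f, spanned S f -> (lab f <= lab e)%N.
Proof.
rewrite /top_spanned; split.
  case: pickP => // e' /andP [se /forallP me] [<-].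
  by split=> // f sf; have := me f; rewrite sf.
case=> se me; case: pickP => [e' /andP [se' /forallP me']|/(_ e)].
  congr Some; apply/lab_inj/val_inj/eqP; rewrite eqn_leq me //.
  by have := me' e; rewrite se.
rewrite se /= => /negbT/forallPn [f].
by rewrite negb_imply => /andP [/me ->].
Qed.

Lemma top_spanned_None S : top_spanned S = None <-> forall e, ~~ spanned S e.
Proof.
split=> [|ns]; last first.
  by rewrite /top_spanned; case: pickP => // e; rewrite (negPf (ns e)).
move=> tS e; apply/negP => se.
have [f sf mf] := arg_maxnP (fun f => val (lab f)) se.
suff : top_spanned S = Some f by rewrite tS.
by apply/top_spannedE; split.
Qed.

Lemma top_spanned_add S e : top_spanned S = Some e -> top_spanned (e |: S) = Some e.
Proof.
move=> /top_spannedE [se me]; apply/top_spannedE; split.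
  exact: spanned_sub (subsetU1 _ _) se.
move=> f sf; rewrite leqNgt; apply/negP => ef.
by have := me f (spanned_U1 se ef sf); rewrite leqNgt ef.
Qed.

Lemma top_spanned_del S e : top_spanned S = Some e -> top_spanned (S :\ e) = Some e.
Proof.
move=> /top_spannedE [se me]; apply/top_spannedE; split; first exact: spanned_D1.
by move=> f sf; apply/me/(spanned_sub (subD1set S e)).
Qed.

Lemma top_spanned_mono S T : S \subset T ->
  (prank lab top_spanned S <= prank lab top_spanned T)%N.
Proof.
move=> ST; rewrite /prank.
case tS : (top_spanned S) => [e|//].
have /top_spannedE [/(spanned_sub ST) se _] := tS.
case tT : (top_spanned T) => [f|].
  by have /top_spannedE [_ mf] := tT; rewrite ltnS; apply: mf.
by have /top_spanned_None/(_ e) := tT; rewrite se.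
Qed.

(** A simple path in [T] between the endpoints of [e] is closed up by [e]. *)
Lemma connect_cycle T e x y : e \notin T -> val e = [set x; y] ->
  connect (adj T) x y -> exists C, [/\ is_cycle C, e \in C & C \subset e |: T].
Proof.
move=> eT eE /connectP [p0 pp0 yE0].
have [p [pp up yE]] : exists p, [/\ path (adj T) x p, uniq (x :: p) & y = last x p].
  by case: (shortenP pp0) yE0 => p *; exists p.
have card2 : #|[set x; y]| = 2 by rewrite -eE; apply: edges2 (valP e).
(* One vertex would make [e] a loop; two would make [e] the only edge of the path, hence a member of
   [T]. *)
have sp : (2 < size (x :: p))%N.
  case: p pp up yE => [|z [|//]] /=.
    by move=> _ _ yx; move: card2; rewrite yx setUid cards1.
  move=> /andP [/existsP [f /andP [fT /eqP fE]] _] _ yz.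
  by case/negP: eT; rewrite (_ : e = f) //; apply: val_inj; rewrite eE fE yz.
set s := x :: p in up sp *.
have cyc : path.cycle (adj (e |: T)) s.
  rewrite /= rcons_path; apply/andP; split.
    apply: sub_path pp => a b /existsP [f /andP [fT fE]].
    by apply/existsP; exists f; rewrite inE fT orbT.
  by apply/existsP; exists e; rewrite setU11 -yE eE setUC /=.
have edgeP z : z \in s -> exists2 f, f \in e |: T & val f = [set z; next s z].
  move=> zs; have /existsP [f /andP [fT /eqP fE]] := next_cycle cyc zs.
  by exists f.
pose pairs := [set [set z; next s z] | z in s].
exists [set f : edge G | val f \in pairs]; split.
- exists s; split=> //; apply/setP => D; apply/imsetP/idP => [[f]|].
    by rewrite inE => fp ->.
  move=> Dp; have /imsetP [z zs DE] := Dp; have [f _ fE] := edgeP z zs.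
  by exists f; rewrite ?inE fE -?DE.
(* [e] is the closing pair: the cyclic successor of the last vertex [y] is [x]. *)
- rewrite inE eE; apply/imsetP; exists y; first by rewrite yE mem_last.
  have := cycle_next up; rewrite [path.cycle _ _]rcons_path => /andP [_ /eqP nl].
  by rewrite yE nl setUC.
apply/subsetP => f; rewrite inE => /imsetP [z zs fE].
by have [g gT gE] := edgeP z zs; rewrite (_ : f = g) //; apply: val_inj; rewrite fE.
Qed.

Lemma spanned_cycle S e : spanned S e ->
  exists C, [/\ is_cycle C, e \in C & C \subset e |: below S e].
Proof.
case/existsP => x /existsP [y /andP [/eqP eE]].
by apply: connect_cycle => //; rewrite !inE ltnn andbF.
Qed.

Lemma connect_comps S T : comps S = comps T ->
  forall x y, connect (adj T) x y -> connect (adj S) x y.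
Proof.
move=> ST x y xy.
(* The class of [x] for [T] is also a class for [S], based at some [a]; thus [S] connects both [x]
   and [y] to [a]. *)
have : [set z in [set: V] | connect (adj T) x z] \in comps S.
  by rewrite ST; apply: imset_f; rewrite inE.
case/imsetP => a _ /setP E.
have := E x; rewrite !inE connect0 => /esym ax.
have := E y; rewrite !inE xy => /esym ay.
by apply: connect_trans ay; rewrite (sym_connect_sym (adj_sym S)).
Qed.

Lemma NBC_spanned S : (S \in NBC lab) = (top_spanned S == None).
Proof.
apply/idP/eqP; rewrite inE top_spanned_None.
  (* A spanned edge carries the largest label on the cycle it closes, so the rest of that cycle is a
     broken circuit inside [S]. *)
  move=> /asboolP nb e; apply/negP => /spanned_cycle [C [cC eC CS]].
  have CE f : f \in C -> f != e -> (f \in S) && (lab f < lab e)%N.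
    move=> fC /negPf fe; have := subsetP CS f fC.
    by rewrite !inE fe.
  have /negP [] : ~~ (C :\ e \subset S).
    apply: nb; exists C, e; split=> // f fC.
    by have [->//|/(CE f fC)/andP [_ /ltnW]] := eqVneq f e.
  by apply/subsetP => f; rewrite !inE => /andP [fe fC]; case/andP: (CE f fC fe).
(* Conversely, [C :\ e] connects the endpoints of [e] by [comps_completes], and its labels are
   strictly smaller by maximality and injectivity, so [S] spans [e]. *)
move=> ns; apply/asboolP => D [C [e [cC eC mC ->]]]; apply/negP => CS.
case/negP: (ns e).
have ce : completes_cycle (C :\ e) e.
  by split; [rewrite !inE eqxx | exists C; rewrite setD1K].
have /eqP/cards2P [x [y [_ eE]]] := edges2 (valP e).
apply/existsP; exists x; apply/existsP; exists y; rewrite eE eqxx /=.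
have : connect (adj (C :\ e)) x y.
  apply: connect_comps (comps_completes ce) _ _ _; apply: connect1.
  by apply/existsP; exists e; rewrite setU11 eE eqxx.
apply: sub_adj_connect => f fC; rewrite !inE (subsetP CS) //=.
move: fC; rewrite !inE => /andP [fe /mC]; rewrite leq_eqVlt => /orP [|//].
by move=> /eqP/val_inj/lab_inj fE; rewrite fE eqxx in fe.
Qed.

Lemma top_spanned_completes S e : top_spanned S = Some e -> e \notin S ->
  completes_cycle S e.
Proof.
move=> /top_spannedE [/spanned_cycle [C [cC eC CS]] _] eS; split=> //.
exists C; split=> //; apply: subset_trans CS _; apply: setUS.
by apply/subsetP => f; rewrite inE => /andP [].
Qed.

End SpannedEdges.

(** * Application to chromatic functors *)

Lemma Mid_bij (K : fieldType) (V : finType) (P P' : {set {set V}}) (eP : P = P') j :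
  bijective (Mid K eP j).
Proof. by case: P' / eP; exists id. Qed.

Theorem theorem6p5 (R : realType) (V : finType) (G : graph V)
  (m : nat) (lab : edge G -> 'I_m) (lab_bij : bijective lab)
  (F : cube_functor (@CSobj (R[i] : fieldType) V G)) (F_CS : chromatic_functor F)
  (k : nat) :
  gmod_iso (cohom F lab [set: {set edge G}] k) (cohom F lab (NBC lab) k).
Proof.
have lab_inj := bij_inj lab_bij.
apply: (@restr_cohom_iso _ _ _ _ _ _ _ lab_inj (top_spanned lab)).
- exact: NBC_spanned.
- exact: top_spanned_add.
- exact: top_spanned_del.
- exact: top_spanned_mono.
(* Adding the selected edge completes a cycle, so the functor acts on the pair by the identity
   transported along equal vertex partitions. *)
move=> T e h j tT eT.
have ce := top_spanned_completes lab_inj tT eT.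
apply: (eq_bij (Mid_bij _ (comps_completes ce) j)) => x.
by rewrite (F_CS _ _ ce).
Qed.
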